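(* Let $d\ge 2$ be an integer and $s\in[\tfrac14,\tfrac12]$. Then $$\alpha(d,4,s)\ \le\ \min\Big\{\frac{d+2}{4s+1},\ \frac{d+4}{8s}\Big\}.$$ In particular: (i) if $s\le \frac14+\frac1d$, then $\alpha(d,4,s)\le \frac{d+2}{4s+1}$; (ii) if $s\ge \frac14+\frac1d$, then $\alpha(d,4,s)\le \frac{d+4}{8s}$. Here $\alpha(d,4,s)$ denotes the smallest exponent $\alpha$ such that every $(4,s)$-Salem set $E\subseteq\mathbb{F}_q^d$ with $|E|\gg q^{\alpha}$ satisfies $|\Delta(E)|\gg q$.
   Context: $\mathbb{F}_q$ is a finite field of odd order $q$; for $\mathbf{x}\in\mathbb{F}_q^d$, $\|\mathbf{x}\|=x_1^2+\cdots+x_d^2$, and $\Delta(E)=\{\|\mathbf{x}-\mathbf{y}\|:\mathbf{x},\mathbf{y}\in E\}\subseteq\mathbb{F}_q$. Fix a nontrivial additive character $\chi$ of $\mathbb{F}_q$ and put $\widehat{E}(\mathbf{x})=q^{-d}\sum_{\mathbf{y}\in E}\chi(-\mathbf{x}\cdot\mathbf{y})$ and $\|\widehat{E}\|_4=\big(q^{-d}\sum_{\mathbf{x}\in\mathbb{F}_q^d\setminus\{\mathbf{0}\}}|\widehat{E}(\mathbf{x})|^4\big)^{1/4}$. A set $E\subseteq\mathbb{F}_q^d$ is $(4,s)$-Salem if $\|\widehat{E}\|_4\ll q^{-d}|E|^{1-s}$. Notation: $A\ll B$ (equivalently $B\gg A$) means $A\le CB$ for a constant $C>0$ not depending on $q$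 or on the sets involved. Implied constants in conclusions may depend on $d$, $s$ and on the implied constants in the hypotheses (including the one in the Salem condition). *)

(* Defs.v *)
From HB Require Import structures.
From mathcomp Require Import all_boot all_order all_algebra.
From mathcomp Require Import complex.
From mathcomp Require Import all_classical all_reals all_analysis.

Set Implicit Arguments.
Unset Strict Implicit.
Unset Printing Implicit Defensive.

Import Order.TTheory GRing.Theory Num.Theory.
Local Open Scope ring_scope.

Section FiniteField.
Variables (F : finFieldType) (d : nat).
Implicit Types (x y : 'rV[F]_d) (E : {set 'rV[F]_d}).

Definition dotv x y : F := \sum_(i < d) x ord0 i * y ord0 i.

Definition sqnorm x : F := \sum_(i < d) x ord0 i ^+ 2.

Definition dist_set E : {set F} := [set sqnorm (x - y) | x in E, y in E].

Variable R : realType.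
Implicit Type chi : F -> R[i].

(* As F is finite, the two equations force chi to take its values in the roots
   of unity. *)
Definition additive_char chi : Prop :=
  chi 0 = 1 /\ forall a b : F, chi (a + b) = chi a * chi b.

Definition nontrivial_char chi : Prop := exists a : F, chi a != 1.

Definition fourier chi E x : R[i] :=
  (#|F|%:R ^- d) * \sum_(y in E) chi (- dotv x y).

(* Normc.normc is the modulus with values in R, whereas `|_| on R[i] takes its
   values in R[i]. *)
Definition fourier_L4 chi E : R :=
  (#|F|%:R ^- d * \sum_(x | x != 0) Normc.normc (fourier chi E x) ^+ 4)
    `^ (4%:R^-1).

(* The (4,s)-Salem condition with explicit implied constant C. *)
Definition salem4 (C s : R) chi E : Prop :=
  fourier_L4 chi E <= C * (#|F|%:R ^- d * #|E|%:R `^ (1 - s)).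

End FiniteField.

(* alpha has the property "every (4,s)-Salem set E with |E| >> q^alpha
   satisfies |Delta(E)| >> q": the constant c' depends only on d, s, alpha and
   on the constants C and c of the hypotheses, and is uniform in the field F
   of odd order q = #|F|, in the character and in E. *)
Definition dist_exponent (R : realType) (d : nat) (s alpha : R) : Prop :=
  forall C c : R, 0 < C -> 0 < c ->
  exists2 c' : R, 0 < c' &
    forall (F : finFieldType) (chi : F -> R[i]) (E : {set 'rV[F]_d}),
      odd #|F| -> additive_char chi -> nontrivial_char chi ->
      salem4 C s chi E ->
      c * #|F|%:R `^ alpha <= #|E|%:R ->
      c' * #|F|%:R <= #|dist_set E|%:R.

(* dist_exponent d s is upward closed in alpha, so the smallest exponent is
   the infimum; it is taken in \bar R to be +oo if there is no exponent. *)
Definition alpha4 (R : realType) (d : nat) (s : R) : \bar R :=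
  ereal_inf [set a%:E | a in [set a : R | dist_exponent d s a]].

(* Main.v *)
Require Import Defs.
From HB Require Import structures.
From mathcomp Require Import all_boot all_order all_algebra all_fingroup all_solvable.
From mathcomp Require Import complex ring lra.
From mathcomp Require Import all_classical all_reals all_analysis.

(* Write N = |E|, q = |F| and let r(u) be the number of pairs of points of E with
   difference u, so that the additive energy of E is L = sum_u r(u)^2.  By
   Plancherel, q^d L = sum_x |E^(x)|^4 for the unnormalised transform of E, and the
   Salem condition reads q^d L <= N^4 + C^4 q^d N^(4-4s).

   Let T count the triples (x,y,z) of points of E with ||x-y|| = ||x-z||.  Cauchy-Schwarz
   gives N^3 <= |Delta(E)| T.  Expanding with characters, q T - N^3 is the sum over
   a <> 0 of X_a = sum_(x in E) |g_a(x)|^2, where g_a is the transform of a function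
   of modulus 1_E.  Since |g_a|^2 is the transform of an autocorrelation bounded by r,
   Cauchy-Schwarz gives both X_a^2 <= N q^d L (extend the sum over x to the whole
   space) and X_a^4 <= N^4 q^d L^2 (sum over x first, and apply Plancherel to E).
   The first bound yields the exponent (d+2)/(4s+1) provided that it is at least 2,
   the second one yields (d+4)/(8s) for d >= 4; for d < 4 the minimum is
   (d+2)/(4s+1).

   If (d+2)/(4s+1) < 2, then it is at least d/(4s), which is an exponent because
   nu(t) = sum_(||u|| = t) r(u) satisfies nu(t)^2 <= 2 q^(d-1) sum_(||u|| = t) r(u)^2, so
   that q N^4 <= |Delta(E)| q sum_t nu(t)^2 <= 2 |Delta(E)| q^d L. *)

Set Implicit Arguments.
Unset Strict Implicit.
Unset Printing Implicit Defensive.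

Import Order.TTheory GRing.Theory Num.Theory.
Local Open Scope ring_scope.

(** * Cauchy-Schwarz, Parseval and characters of finite abelian groups *)

Lemma sqr_sum_mul_le (R : numDomainType) (I : finType) (P : pred I)
    (a b : I -> R) :
    (forall i, P i -> 0 <= a i) -> (forall i, P i -> 0 <= b i) ->
  (\sum_(i | P i) a i * b i) ^+ 2 <=
    (\sum_(i | P i) a i ^+ 2) * (\sum_(i | P i) b i ^+ 2).
Proof.
(* Lagrange's identity: twice the difference of the two sides is the double sum of the squares of
   [a i * b j - a j * b i]. *)
move=> a0 b0; rewrite -subr_ge0 -(pmulrn_lge0 _ (ltn0Sn 1)) mulr2n.
rewrite expr2 !big_distrlr /= [X in _ + (X - _)]exchange_big -!sumrB -big_split /=.
apply: sumr_ge0 => i Pi; rewrite -!sumrB -big_split /=.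
apply: sumr_ge0 => j Pj.
have -> : a i ^+ 2 * b j ^+ 2 - a i * b i * (a j * b j)
    + (a j ^+ 2 * b i ^+ 2 - a i * b i * (a j * b j)) =
    (a i * b j - a j * b i) ^+ 2 by ring.
apply: real_exprn_even_ge0 => //.
by rewrite rpredB // ger0_real // mulr_ge0 // ?a0 ?b0.
Qed.

(** Translating the summation variable by v multiplies the sum by [h v]. *)
Lemma sum_character_eq0 (V : finZmodType) (R : idomainType) (h : V -> R) :
    {morph h : x y / x + y >-> x * y} -> (exists v, h v != 1) ->
  \sum_x h x = 0.
Proof.
move=> hD [v hv]; apply: (@mulIf _ (h v - 1)); first by rewrite subr_eq0.
rewrite mul0r mulrBr mulr1 mulr_suml; apply/eqP; rewrite subr_eq0; apply/eqP.
rewrite [RHS](reindex_inj (addIr v)) /=.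
by apply: eq_bigr => x _; rewrite hD.
Qed.

(** Parseval for a kernel with orthogonal columns; it serves both for the pairing of vectors and for
    the pairing [a * t] on the field. *)
Lemma orthogonal_sum_norm2 (R : numClosedFieldType) (W V : finType)
    (M : R) (K : W -> V -> R) (h : V -> R) :
    (forall u v, \sum_w K w u * (K w v)^* = M *+ (u == v)) ->
  \sum_w `|\sum_u h u * K w u| ^+ 2 = M * \sum_u `|h u| ^+ 2.
Proof.
move=> KK.
transitivity (\sum_w \sum_u \sum_v h u * (h v)^* * (K w u * (K w v)^*)).
  apply: eq_bigr => w _; rewrite normCK rmorph_sum /= big_distrlr /=.
  by apply: eq_bigr => u _; apply: eq_bigr => v _; rewrite rmorphM mulrACA.
rewrite exchange_big mulr_sumr; apply: eq_bigr => u _ /=.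
rewrite exchange_big (bigD1 u) //= -mulr_sumr KK eqxx mulr1n normCK mulrC.
rewrite big1 ?addr0 // => v; rewrite eq_sym -mulr_sumr KK => /negPf->.
by rewrite mulr0n mulr0.
Qed.

Lemma mulrn_card (V : finZmodType) (x : V) : x *+ #|V| = 0.
Proof. by rewrite -FinRing.zmodXgE -cardsT; apply: expg_cardG; rewrite inE. Qed.

Lemma odd_card_natr2_neq0 (F : finNzRingType) : odd #|F| -> 2%:R != 0 :> F.
Proof.
move=> oF; apply/eqP => F2; have := mulrn_card (1 : F).
rewrite -(odd_double_half #|F|) oF -mul2n mulrnDr mulrnA F2 mul0rn addr0.
by move/eqP; rewrite mulr1n oner_eq0.
Qed.

(** By Lagrange, [chi a] is a root of unity of order dividing [#|F|]. *)
Lemma character_norm (F : finZmodType) (C : numClosedFieldType) (chi : F -> C) (a : F) :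
    chi 0 = 1 -> {morph chi : x y / x + y >-> x * y} -> `|chi a| = 1.
Proof.
move=> chi0 chiD.
have chiX n : chi (a *+ n) = chi a ^+ n.
  by elim: n => [|n IHn]; rewrite ?mulr0n // mulrS exprS chiD IHn.
have F0 : (0 < #|F|)%N by apply/card_gt0P; exists 0.
apply/eqP; rewrite -(@pexpr_eq1 _ _ #|F|) //.
by rewrite -normrX -chiX mulrn_card chi0 normr1.
Qed.

Lemma character_conj (F : finZmodType) (C : numClosedFieldType) (chi : F -> C) (a : F) :
    chi 0 = 1 -> {morph chi : x y / x + y >-> x * y} -> (chi a)^* = chi (- a).
Proof.
move=> chi0 chiD; have n1 := character_norm a chi0 chiD.
have nz : chi a != 0 by rewrite -normr_eq0 n1 oner_eq0.
by apply: (mulfI nz); rewrite -normCK n1 expr1n -chiD subrr chi0.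
Qed.

(** * Energy and Fourier transform on a finite abelian group *)

Section Correlation.
Variable V : finZmodType.
Implicit Type E : {set V}.

Definition addcorr E (u : V) : nat := #|[set y in E | y + u \in E]|.

Definition energy E : nat := (\sum_u addcorr E u ^ 2)%N.

Lemma sum_addcorr E : (\sum_u addcorr E u = #|E| ^ 2)%N.
Proof.
under eq_bigr => u _ do rewrite /addcorr -sum1dep_card big_mkcondr /=.
rewrite exchange_big /=.
under eq_bigr => y _.
  rewrite (reindex_inj (addrI (- y))) /=.
  under eq_bigr => u _ do rewrite addrA subrr add0r.
  rewrite -big_mkcond sum1_card.
  over.
by rewrite sum_nat_const mulnn.
Qed.

Variable C : numClosedFieldType.
Implicit Type f : V -> C.

Definition autocorr f (u : V) : C := \sum_y f (y + u) * (f y)^*.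

Lemma autocorr_indic E u : autocorr (fun y => (y \in E)%:R) u = (addcorr E u)%:R.
Proof.
rewrite /addcorr -sum1dep_card natr_sum big_mkcond /=.
apply: eq_bigr => y _.
rewrite conjC_nat -natrM.
by case: (y \in E); rewrite ?andbF ?muln0 ?muln1 //=; case: ifP.
Qed.

Lemma autocorr_le E f u : (forall y, `|f y| <= (y \in E)%:R) ->
  `|autocorr f u| <= (addcorr E u)%:R.
Proof.
move=> fE; rewrite -autocorr_indic; apply: le_trans (ler_norm_sum _ _ _) _.
apply: ler_sum => y _; rewrite normrM norm_conjC conjC_nat.
by apply: ler_pM.
Qed.

(** [K x u] stands for psi(x.u) with [M] = q^d. The character psi stays free: it is t -> chi(-t) for
    the Salem condition and t -> chi(-2at) for the pinned sums. *)
Variables (M : nat) (K : V -> V -> C).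
Hypothesis KD : forall x, {morph K x : u v / u + v >-> u * v}.
Hypothesis Kconj : forall x u, (K x u)^* = K x (- u).
Hypothesis Ksym : forall x u, K x u = K u x.
Hypothesis Korth : forall u v, \sum_x K x u * (K x v)^* = M%:R *+ (u == v).

Definition ktransform f (x : V) : C := \sum_u f u * K x u.

(** Wiener-Khinchin: expand the square and sum over the difference of the two variables. *)
Lemma ktransform_norm2 f x : `|ktransform f x| ^+ 2 = ktransform (autocorr f) x.
Proof.
rewrite normCK rmorph_sum /= big_distrlr /= exchange_big /=.
under [RHS]eq_bigr => u _ do rewrite mulr_suml.
rewrite [RHS]exchange_big /=; apply: eq_bigr => y _.
rewrite (reindex_inj (addrI y)) /=; apply: eq_bigr => u _.
by rewrite rmorphM /= mulrACA Kconj -KD addrAC subrr add0r.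
Qed.

Lemma ktransform_norm4 f :
  \sum_x `|ktransform f x| ^+ 4 = M%:R * \sum_u `|autocorr f u| ^+ 2.
Proof.
rewrite -(orthogonal_sum_norm2 _ Korth); apply: eq_bigr => x _.
by rewrite -/(ktransform _ x) -ktransform_norm2 normrX normr_id -exprM.
Qed.

Lemma energy_ktransform E :
  (M * energy E)%:R = \sum_x `|ktransform (fun y => (y \in E)%:R) x| ^+ 4.
Proof.
rewrite ktransform_norm4 natrM natr_sum; congr (_ * _); apply: eq_bigr => u _.
by rewrite autocorr_indic normr_nat natrX.
Qed.

Lemma ktransform_norm4_le E f : (forall y, `|f y| <= (y \in E)%:R) ->
  \sum_x `|ktransform f x| ^+ 4 <= (M * energy E)%:R.
Proof.
move=> fE; rewrite ktransform_norm4 natrM natr_sum ler_wpM2l //.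
by apply: ler_sum => u _; rewrite natrX lerXn2r ?nnegrE // autocorr_le.
Qed.

Lemma restricted_energy_bound2 E f : (forall y, `|f y| <= (y \in E)%:R) ->
  (\sum_(x in E) `|ktransform f x| ^+ 2) ^+ 2 <= (#|E| * (M * energy E))%:R.
Proof.
move=> fE; rewrite natrM.
under eq_bigr => x _ do rewrite -[_ ^+ 2]mul1r.
apply: le_trans (sqr_sum_mul_le _ _) _ => [//|x _|]; first by rewrite exprn_ge0.
under eq_bigr do rewrite expr1n.
rewrite sumr_const ler_wpM2l //.
apply: le_trans (ktransform_norm4_le fE).
under eq_bigr do rewrite -exprM.
by rewrite [leRHS](bigID (mem E)) /= lerDl sumr_ge0 // => x _; rewrite exprn_ge0.
Qed.

(** Summing over x in E first turns the kernel into the transform of the indicator of E, so the sum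
    is at most A = sum_u r(u) |I^(u)|. Cauchy-Schwarz with weight r, of total mass N^2, gives A^2 <=
    N^2 B with B = sum_u r(u) |I^(u)|^2, and a second one gives B^2 <= M L^2. *)
Lemma restricted_energy_bound4 E f : (forall y, `|f y| <= (y \in E)%:R) ->
  (\sum_(x in E) `|ktransform f x| ^+ 2) ^+ 4
    <= (#|E| ^ 4 * (M * energy E ^ 2))%:R.
Proof.
move=> fE; set I := fun y => (y \in E)%:R : C.
have X0 : 0 <= \sum_(x in E) `|ktransform f x| ^+ 2.
  by apply: sumr_ge0 => x _; rewrite exprn_ge0.
have XE : \sum_(x in E) `|ktransform f x| ^+ 2 <=
    \sum_u (addcorr E u)%:R * `|ktransform I u|.
  rewrite -(ger0_norm X0).
  under eq_bigr => x _ do rewrite ktransform_norm2 /ktransform.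
  rewrite exchange_big /=; apply: le_trans (ler_norm_sum _ _ _) _.
  apply: ler_sum => u _; rewrite -mulr_sumr normrM.
  suff -> : \sum_(x in E) K x u = ktransform I u.
    by rewrite ler_wpM2r // autocorr_le.
  rewrite big_mkcond; apply: eq_bigr => x _; rewrite /I Ksym.
  by case: ifP; rewrite ?mul1r ?mul0r.
have S1 : (\sum_u (addcorr E u)%:R * `|ktransform I u|) ^+ 2 <=
    (#|E| ^ 2)%:R * \sum_u (addcorr E u)%:R * `|ktransform I u| ^+ 2.
  (* The weighted inequality comes from the plain one by splitting r as sqrt(r) * sqrt(r). *)
  have : (\sum_u sqrtC (addcorr E u)%:R * (sqrtC (addcorr E u)%:R * `|ktransform I u|)) ^+ 2
      <= (\sum_u sqrtC (addcorr E u)%:R ^+ 2) *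
         \sum_u (sqrtC (addcorr E u)%:R * `|ktransform I u|) ^+ 2.
    by apply: sqr_sum_mul_le => u _; rewrite ?mulr_ge0 ?sqrtC_ge0.
  under eq_bigr => u _ do rewrite mulrA -expr2 sqrtCK.
  under [X in X * _]eq_bigr => u _ do rewrite sqrtCK.
  rewrite -natr_sum sum_addcorr.
  by under [X in _ * X]eq_bigr => u _ do rewrite exprMn sqrtCK.
have S2 : (\sum_u (addcorr E u)%:R * `|ktransform I u| ^+ 2) ^+ 2 <=
    (M * energy E ^ 2)%:R.
  apply: le_trans (sqr_sum_mul_le _ _) _ => [//|u _|]; first by rewrite exprn_ge0.
  under [X in _ * X]eq_bigr do rewrite -exprM.
  rewrite (_ : \sum_i (addcorr E i)%:R ^+ 2 = (energy E)%:R); last first.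
    by rewrite natr_sum; apply: eq_bigr => u _; rewrite natrX.
  by rewrite -energy_ktransform -natrM mulnCA mulnn.
set A := \sum_u _ * _ in XE S1; set B := \sum_u _ * _ in S1 S2.
have A0 : 0 <= A by apply: le_trans XE.
have B0 : 0 <= B by apply: sumr_ge0 => u _; rewrite mulr_ge0 ?exprn_ge0.
rewrite natrM; apply: (@le_trans _ _ ((A ^+ 2) ^+ 2)).
  by rewrite -exprM lerXn2r ?nnegrE.
apply: (@le_trans _ _ (((#|E| ^ 2)%:R * B) ^+ 2)).
  by rewrite lerXn2r ?nnegrE ?exprn_ge0 ?mulr_ge0.
by rewrite exprMn -natrX -expnM ler_wpM2l.
Qed.
End Correlation.

Lemma sqr_sum_le_card (I : finType) (A : {set I}) (n : I -> nat) :
  ((\sum_(i in A) n i) ^ 2 <= #|A| * \sum_(i in A) n i ^ 2)%N.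
Proof.
have := @sqr_sum_mul_le int _ (mem A) (fun=> 1) (fun i => (n i)%:R).
move=> /(_ (fun _ _ => ler01) (fun _ _ => ler0n _ _)).
rewrite expr1n sumr_const (eq_bigr (fun i => (n i)%:R)) => [|i _]; last exact: mul1r.
rewrite [X in _ <= _ * X](eq_bigr (fun i => (n i ^ 2)%:R)) => [|i _]; last first.
  by rewrite natrX.
by rewrite -!natr_sum -natrX -natrM ler_nat.
Qed.

(** Each term is at most the root of order n+1 of [B], and there are at most [#|I|] terms. *)
Lemma sumr_expn_le (C : numClosedFieldType) (I : finType) (P : pred I)
    (X : I -> C) (n : nat) (B : C) : 0 <= B ->
    (forall i, P i -> 0 <= X i) -> (forall i, P i -> X i ^+ n.+1 <= B) ->
  (\sum_(i | P i) X i) ^+ n.+1 <= (#|I| ^ n.+1)%:R * B.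
Proof.
move=> B0 X0 XB; have r0 : 0 <= n.+1.-root B by rewrite rootC_ge0.
rewrite -(rootCK (ltn0Sn n) B) natrX -exprMn lerXn2r ?nnegrE ?sumr_ge0 ?mulr_ge0 //.
apply: (@le_trans _ _ (\sum_(i | P i) n.+1.-root B)).
  apply: ler_sum => i Pi; rewrite -(@ler_pXn2r _ n.+1) ?nnegrE ?X0 //.
  by rewrite rootCK ?XB.
by rewrite sumr_const -[leLHS]mulr_natl ler_wpM2r // ler_nat max_card.
Qed.

(** * Pinned distances *)

Section Vectors.
Variables (F : finFieldType) (d : nat).
Implicit Types (x y u v : 'rV[F]_d) (E : {set 'rV[F]_d}).

Lemma dotvC x y : dotv x y = dotv y x.
Proof. by apply: eq_bigr => i _; rewrite mulrC. Qed.

Lemma dotvDr x u v : dotv x (u + v) = dotv x u + dotv x v.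
Proof. by rewrite -big_split; apply: eq_bigr => i _; rewrite mxE mulrDr. Qed.

Lemma dotvNr x u : dotv x (- u) = - dotv x u.
Proof. by rewrite -sumrN; apply: eq_bigr => i _; rewrite mxE mulrN. Qed.

Lemma dotv0 x : dotv x 0 = 0.
Proof. by apply: big1 => i _; rewrite mxE mulr0. Qed.

Lemma dotv_surj u (t : F) : u != 0 -> exists x, dotv x u = t.
Proof.
move=> u0; have [i ui] : exists i, u ord0 i != 0.
  apply/existsP; apply: contraNT u0; rewrite negb_exists => /forallP u0.
  by apply/eqP/rowP => i; rewrite mxE; apply/eqP; rewrite -[_ == _]negbK u0.
exists (\row_j (if j == i then t / u ord0 i else 0)).
rewrite /dotv (bigD1 i) //= mxE eqxx divfK // big1 ?addr0 // => j /negPf ji.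
by rewrite mxE ji mul0r.
Qed.

Lemma sqnormB x y : sqnorm (x - y) = sqnorm x + sqnorm y - (2%:R * dotv x y).
Proof.
rewrite mulr_sumr -sumrN -!big_split; apply: eq_bigr => i _ /=.
by rewrite !mxE; ring.
Qed.

(** This is the number T of triples, grouped by the pin x and the common distance t. *)
Definition pinned_energy E : nat :=
  (\sum_(x in E) \sum_(t : F) #|[set y in E | sqnorm (x - y) == t]| ^ 2)%N.

Lemma cube_le_pinned_energy E : (#|E| ^ 3 <= #|dist_set E| * pinned_energy E)%N.
Proof.
rewrite expnS -sum_nat_const /pinned_energy big_distrr /=.
apply: leq_sum => x xE; pose nu t := #|[set y in E | sqnorm (x - y) == t]|.
have -> : #|E| = (\sum_(t in dist_set E) nu t)%N.
  rewrite -sum1_card (partition_big (fun y => sqnorm (x - y)) (mem (dist_set E))) /=.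
    by apply: eq_bigr => t _; rewrite sum1dep_card.
  by move=> y yE; apply/imset2P; exists x y.
apply: (@leq_trans (#|dist_set E| * \sum_(t in dist_set E) nu t ^ 2)%N).
  exact: sqr_sum_le_card.
by rewrite leq_mul2l [leqRHS](bigID (mem (dist_set E))) /= leq_addr orbT.
Qed.

Variables (C : numClosedFieldType) (chi : F -> C).
Hypothesis chi0 : chi 0 = 1.
Hypothesis chiD : {morph chi : a b / a + b >-> a * b}.
Hypothesis chi_neq1 : exists a, chi a != 1.

Lemma sum_chi_mulr (b : F) : \sum_a chi (a * b) = #|F|%:R *+ (b == 0).
Proof.
have [->|b0] := eqVneq b 0.
  under eq_bigr do rewrite mulr0 chi0.
  by rewrite sumr_const.
apply: sum_character_eq0 => [x y|]; first by rewrite mulrDl chiD.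
by have [a ha] := chi_neq1; exists (a / b); rewrite divfK.
Qed.

Lemma sum_chi_dotv u : \sum_x chi (dotv x u) = (#|F| ^ d)%:R *+ (u == 0).
Proof.
have [->|u0] := eqVneq u 0.
  under eq_bigr do rewrite dotv0 chi0.
  by rewrite sumr_const card_mx mul1n.
apply: sum_character_eq0 => [x y|].
  by rewrite dotvC dotvDr chiD dotvC (dotvC u).
by have [a ha] := chi_neq1; have [x xE] := dotv_surj a u0; exists x; rewrite xE.
Qed.

Lemma sum_chi_dotv_conj u v :
  \sum_x chi (dotv x u) * (chi (dotv x v))^* = (#|F| ^ d)%:R *+ (u == v).
Proof.
under eq_bigr do rewrite character_conj // -chiD -dotvNr -dotvDr.
by rewrite sum_chi_dotv subr_eq0.
Qed.
End Vectors.

(** * Exponential sums controlling the pinned distances *)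

Section Pinned.
Variables (F : finFieldType) (d : nat).
Implicit Types (x y u v : 'rV[F]_d) (E : {set 'rV[F]_d}).
Variables (C : numClosedFieldType) (chi : F -> C).
Hypothesis chi0 : chi 0 = 1.
Hypothesis chiD : {morph chi : a b / a + b >-> a * b}.
Hypothesis chi_neq1 : exists a, chi a != 1.

Definition pinned_sum E (a : F) : C :=
  \sum_(x in E) `|\sum_(y in E) chi (a * sqnorm (x - y))| ^+ 2.

(** For each pin x, this is Parseval on the field applied to the number of points of E at distance t
    from x. *)
Lemma sum_pinned_sum E : \sum_a pinned_sum E a = (#|F| * pinned_energy E)%:R.
Proof.
rewrite exchange_big natrM natr_sum mulr_sumr; apply: eq_bigr => x xE /=.
have KK (s t : F) : \sum_a chi (a * s) * (chi (a * t))^* = #|F|%:R *+ (s == t).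
  under eq_bigr do rewrite character_conj // -chiD -mulrBr.
  by rewrite (sum_chi_mulr chi0 chiD chi_neq1) subr_eq0.
have := orthogonal_sum_norm2 (fun t => #|[set y in E | sqnorm (x - y) == t]|%:R) KK.
rewrite natr_sum; under [in RHS]eq_bigr do rewrite normr_nat -natrX.
move=> <-; apply: eq_bigr => a _; congr (`|_| ^+ 2).
rewrite (partition_big (fun y => sqnorm (x - y)) xpredT) //=.
apply: eq_bigr => t _; rewrite -sum1dep_card natr_sum mulr_suml.
by apply: eq_bigr => y /andP[_ /eqP->]; rewrite mul1r.
Qed.

Lemma pinned_sum0 E : pinned_sum E 0 = (#|E| ^ 3)%:R.
Proof.
rewrite /pinned_sum (eq_bigr (fun=> (#|E| ^ 2)%:R)) => [|x _].
  by rewrite sumr_const -mulrnA -expnSr.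
under eq_bigr do rewrite mul0r chi0.
by rewrite sumr_const normr_nat -natrX.
Qed.

Lemma pinned_sum_ge0 E a : 0 <= pinned_sum E a.
Proof. by apply: sumr_ge0 => x _; rewrite exprn_ge0. Qed.

Hypothesis oddF : odd #|F|.

(** Expanding ||x-y|| = ||x|| + ||y|| - 2 x.y separates the variables: the y-part is a phase on the
    indicator of E, and the cross term is a kernel for the character t -> chi(-2at), nontrivial
    because the order of the field is odd. *)
Lemma pinned_sum_bounds E a : a != 0 ->
  pinned_sum E a ^+ 2 <= (#|E| * (#|F| ^ d * energy E))%:R /\
  pinned_sum E a ^+ 4 <= (#|E| ^ 4 * (#|F| ^ d * energy E ^ 2))%:R.
Proof.
move=> a0; set psi := fun t => chi (- (a * 2%:R) * t).
have psi0 : psi 0 = 1 by rewrite /psi mulr0.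
have psiD : {morph psi : s t / s + t >-> s * t}.
  by move=> s t; rewrite /psi mulrDr chiD.
have psi1 : exists t, psi t != 1.
  have [b hb] := chi_neq1; exists (b / - (a * 2%:R)).
  by rewrite /psi mulrC divfK // oppr_eq0 mulf_neq0 // odd_card_natr2_neq0.
pose K x y := psi (dotv x y).
pose f y := (y \in E)%:R * chi (a * sqnorm y).
have fE y : `|f y| <= (y \in E)%:R.
  by rewrite normrM (character_norm _ chi0 chiD) mulr1 normr_nat.
have -> : pinned_sum E a = \sum_(x in E) `|ktransform K f x| ^+ 2.
  apply: eq_bigr => x _; congr (_ ^+ 2).
  (* The phase chi(a ||x||) has modulus 1, so it can be put back inside the norm. *)
  rewrite -[RHS]mul1r -(character_norm (a * sqnorm x) chi0 chiD) -normrM.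
  congr `|_|; rewrite mulr_sumr big_mkcond; apply: eq_bigr => y _.
  rewrite /f /K /psi; case: ifP => _; last by rewrite !mul0r mulr0.
  by rewrite mul1r -!chiD sqnormB; congr chi; ring.
have KD x : {morph K x : u v / u + v >-> u * v}.
  by move=> u v; rewrite /K dotvDr psiD.
have Kconj x u : (K x u)^* = K x (- u) by rewrite /K character_conj // dotvNr.
have Ksym x u : K x u = K u x by rewrite /K dotvC.
have Korth := sum_chi_dotv_conj psi0 psiD psi1.
split; first exact: (restricted_energy_bound2 KD Kconj (Korth d) fE).
exact: (restricted_energy_bound4 KD Kconj Ksym (Korth d) fE).
Qed.

(** The truncated subtraction is a genuine one: the term a = 0 is N^3 and the other terms are
    nonnegative. *)
Lemma pinned_energy_excess E :
  (#|F| * pinned_energy E - #|E| ^ 3)%:R = \sum_(a | a != 0) pinned_sum E a.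
Proof.
have H : (#|F| * pinned_energy E)%:R =
    (#|E| ^ 3)%:R + \sum_(a | a != 0) pinned_sum E a.
  by rewrite -sum_pinned_sum (bigD1 0) //= pinned_sum0.
rewrite natrB ?H ?(addrC _%:R) ?addrK //.
by rewrite -(ler_nat C) H lerDl sumr_ge0 // => a _; rewrite pinned_sum_ge0.
Qed.

Lemma pinned_energy_excess2 E :
  ((#|F| * pinned_energy E - #|E| ^ 3) ^ 2 <=
    #|F| ^ 2 * (#|E| * (#|F| ^ d * energy E)))%N.
Proof.
rewrite -(ler_nat C) natrX pinned_energy_excess natrM.
apply: sumr_expn_le => [|a a0|a a0]; first exact: ler0n.
  exact: pinned_sum_ge0.
by have [] := pinned_sum_bounds E a0.
Qed.

Lemma pinned_energy_excess4 E :
  ((#|F| * pinned_energy E - #|E| ^ 3) ^ 4 <=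
    #|F| ^ 4 * (#|E| ^ 4 * (#|F| ^ d * energy E ^ 2)))%N.
Proof.
rewrite -(ler_nat C) natrX pinned_energy_excess natrM.
apply: sumr_expn_le => [|a a0|a a0]; first exact: ler0n.
  exact: pinned_sum_ge0.
by have [] := pinned_sum_bounds E a0.
Qed.
End Pinned.

(** * Sphere sizes and the quartic energy bound *)

Lemma card_sqr_eq_le2 (F : finIdomainType) (c : F) :
  (#|[set z : F | z ^+ 2 == c]| <= 2)%N.
Proof.
have [->|[z]] := set_0Vmem [set z : F | z ^+ 2 == c]; first by rewrite cards0.
rewrite inE => /eqP <-; apply: (@leq_trans #|[set z; - z]|).
  by apply/subset_leq_card/fintype.subsetP => y; rewrite !inE eqf_sqr.
by rewrite cards2; case: (_ != _).
Qed.

Section Spheres.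
Variable F : finFieldType.

(** Once all coordinates but the first are fixed, the first one is a square root of a given
    element. *)
Lemma card_sphere_le (d : nat) (t : F) :
  (#|[set x : 'rV[F]_d.+1 | sqnorm x == t]| <= 2 * #|F| ^ d)%N.
Proof.
rewrite mulnC -[d in (_ ^ d)%N]mul1n -card_mx -sum_nat_const.
rewrite -sum1dep_card (partition_big (fun x => col' ord0 x) xpredT) //=.
apply: leq_sum => y _; rewrite sum1dep_card.
pose S := [set x : 'rV[F]_d.+1 | (sqnorm x == t) && (col' ord0 x == y)].
rewrite -/S; have Sinj : {in S &, injective (fun x : 'rV[F]_d.+1 => x ord0 ord0)}.
  move=> x x'; rewrite !inE => /andP[_ /eqP xy] /andP[_ /eqP x'y] xx'.
  apply/rowP => i; have [j ->|->//] := unliftP ord0 i.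
  by move/rowP/(_ j): xy; move/rowP/(_ j): x'y; rewrite !mxE => -> ->.
rewrite -(card_in_imset Sinj); apply: leq_trans (card_sqr_eq_le2 (t - sqnorm y)).
apply/subset_leq_card/fintype.subsetP => z /imsetP[x].
rewrite !inE => /andP[/eqP<- /eqP<-] ->.
rewrite /sqnorm big_ord_recl.
by under [X in _ - X]eq_bigr do rewrite mxE; rewrite addrK.
Qed.

(** Differences of points of E have their norm in the distance set, so the nu(t) with t in that set
    add up to N^2. Cauchy-Schwarz is used over the distance set, then over each sphere. *)
Lemma quartic_energy_bound (d : nat) (E : {set 'rV[F]_d.+1}) :
  (#|F| * #|E| ^ 4 <= #|dist_set E| * (2 * (#|F| ^ d.+1 * energy E)))%N.
Proof.
pose nu (t : F) := (\sum_(u : 'rV[F]_d.+1 | sqnorm u == t) addcorr E u)%N.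
have nuE : (#|E| ^ 2 = \sum_(t in dist_set E) nu t)%N.
  rewrite -sum_addcorr (bigID (fun u : 'rV[F]_d.+1 => sqnorm u \in dist_set E)) /=.
  rewrite [X in (_ + X)%N]big1 ?addn0 => [|u uE].
    rewrite (partition_big (@sqnorm F d.+1) (mem (dist_set E))) //=.
    apply: eq_bigr => t tE; apply: eq_bigl => u.
    by case: eqP => [->|]; rewrite ?andbF // andbT tE.
  apply/eqP; rewrite cards_eq0 -finset.subset0; apply/fintype.subsetP => y.
  rewrite !inE => /andP[yE yuE].
  case/negP: uE; apply/imset2P; exists (y + u) y => //.
  by rewrite addrAC subrr add0r.
have nu2 t : (nu t ^ 2 <= 2 * #|F| ^ d *
    \sum_(u : 'rV[F]_d.+1 | sqnorm u == t) addcorr E u ^ 2)%N.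
  apply: leq_trans (leq_mul (card_sphere_le d t) (leqnn _)).
  have := sqr_sum_le_card [set x : 'rV[F]_d.+1 | sqnorm x == t] (addcorr E).
  by congr (_ ^ 2 <= _ * _)%N; apply: eq_bigl => u; rewrite inE.
rewrite [(_ ^ 4)%N](expnM _ 2 2) nuE.
apply: (@leq_trans (#|F| * (#|dist_set E| * \sum_(t in dist_set E) nu t ^ 2))%N).
  by rewrite leq_mul2l sqr_sum_le_card orbT.
rewrite mulnCA leq_mul2l; apply/orP; right.
apply: (@leq_trans (#|F| * \sum_(t : F) nu t ^ 2)%N).
  by rewrite leq_mul2l [leqRHS](bigID (mem (dist_set E))) /= leq_addr orbT.
rewrite expnS -mulnA mulnCA leq_mul2l; apply/orP; right.
rewrite /energy (partition_big (@sqnorm F d.+1) xpredT) //= mulnA big_distrr /=.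
by apply: leq_sum => t _; apply: nu2.
Qed.
End Spheres.

(** * Distance exponents of Salem sets *)

Section Salem.
Variables (R : realType) (F : finFieldType) (n : nat) (chi : F -> R[i]).
Hypothesis chi_char : additive_char chi.
Hypothesis chi_neq1 : nontrivial_char chi.
Implicit Type E : {set 'rV[F]_n}.
Local Notation q := (#|F|%:R : R).

(** The factor [q ^+ n ^+ 4] undoes the normalisation of [fourier]; the frequency 0, excluded from
    the Salem norm, contributes N^4. *)
Lemma energy_fourier E : (#|F| ^ n * energy E)%:R =
  #|E|%:R ^+ 4 + q ^+ n ^+ 4 * \sum_(x | x != 0) Normc.normc (fourier chi E x) ^+ 4.
Proof.
have [chi0 chiD] := chi_char.
pose psi t := chi (- t).
have psi0 : psi 0 = 1 by rewrite /psi oppr0.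
have psiD : {morph psi : s t / s + t >-> s * t} by move=> s t; rewrite /psi opprD chiD.
have psi1 : exists t, psi t != 1.
  by have [b hb] := chi_neq1; exists (- b); rewrite /psi opprK.
pose K (x y : 'rV[F]_n) := psi (dotv x y).
have KD x : {morph K x : u v / u + v >-> u * v}.
  by move=> u v; rewrite /K dotvDr psiD.
have Kconj x u : (K x u)^* = K x (- u) by rewrite /K character_conj // dotvNr.
have Korth := sum_chi_dotv_conj psi0 psiD psi1.
have := energy_ktransform KD Kconj (Korth n) E.
have normE x : `|ktransform K (fun y => (y \in E)%:R) x| =
    (q ^+ n * Normc.normc (fourier chi E x))%:C%C.
  have -> : ktransform K (fun y => (y \in E)%:R) x = (q ^+ n)%:C%C * fourier chi E x.
    rewrite /fourier mulrA rmorphXn /= rmorph_nat divff ?mul1r; last first.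
      by rewrite expf_neq0 // pnatr_eq0 -lt0n; apply/card_gt0P; exists 0.
    rewrite [RHS]big_mkcond; apply: eq_bigr => y _.
    by case: ifP; rewrite ?mul1r ?mul0r.
  rewrite normrM [RHS]rmorphM; congr (_ * _).
  by rewrite ger0_norm // lecR exprn_ge0.
have norm0 : (q ^+ n * Normc.normc (fourier chi E 0))%:C%C = #|E|%:R.
  rewrite -normE /ktransform.
  under eq_bigr => y _ do rewrite /K dotvC dotv0 psi0 mulr1.
  by rewrite -natr_sum normr_nat -big_mkcond sum1_card.
under eq_bigr do rewrite normE -rmorphXn exprMn.
rewrite (bigD1 0) //= -exprMn rmorphXn /= norm0 -rmorph_sum /= => HE.
apply: (@complexI R); rewrite rmorph_nat HE rmorphD rmorphXn /= rmorph_nat.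
by rewrite -mulr_sumr.
Qed.

Lemma salem_energy_le (C s : R) E : (0 < #|E|)%N -> 0 <= C -> salem4 C s chi E ->
  (#|F| ^ n * energy E)%:R <= 
    #|E|%:R ^+ 4 + C ^+ 4 * q ^+ n * #|E|%:R ^+ 4 / #|E|%:R `^ (4%:R * s).
Proof.
rewrite -(ltr0n R) energy_fourier lerD2l /salem4 /fourier_L4; set N := #|E|%:R.
move=> N0 C0; set S := \sum_(x | _) _ => SC.
have Q0 : 0 < q ^+ n by rewrite exprn_gt0 // ltr0n; apply/card_gt0P; exists 0.
have S0 : 0 <= (q ^- n * S).
  rewrite mulr_ge0 ?invr_ge0 ?(ltW Q0) // sumr_ge0 // => x _.
  exact: exprn_even_ge0.
have : q ^- n * S <= (C * (q ^- n * N `^ (1 - s))) ^+ 4.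
  (* The exponent 1 is written as 4^-1 * 4, so that the fourth root of [fourier_L4] appears. *)
  rewrite -[leLHS](powRr1 S0) -[X in powR _ X](@mulVf _ 4%:R) ?pnatr_eq0 //.
  rewrite powRrM powR_mulrn ?powR_ge0 // lerXn2r // nnegrE ?powR_ge0 //.
  exact: le_trans (powR_ge0 _ _) SC.
have -> : (C * (q ^- n * N `^ (1 - s))) ^+ 4 = 
    C ^+ 4 * q ^- n ^+ 4 * (N ^+ 4 / N `^ (4%:R * s)).
  rewrite !exprMn mulrA; congr (_ * _).
  rewrite -powR_mulrn ?powR_ge0 // -powRrM mulrBl mul1r powRB; last first.
    by rewrite (gt_eqF N0) implybT.
  by rewrite powR_mulrn ?(ltW N0) // (mulrC s).
move=> SC'.
have -> : q ^+ n ^+ 4 * S = q ^+ n ^+ 5 * (q ^- n * S) by field; rewrite gt_eqF.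
apply: le_trans (ler_wpM2l _ SC') _; first by rewrite exprn_ge0 // ltW.
rewrite le_eqVlt; apply/orP; left; apply/eqP; field.
by rewrite !gt_eqF // powR_gt0.
Qed.
End Salem.

(** * From energy bounds to distance exponents *)

Section Exponents.
Variable R : realType.
Implicit Types (s alpha beta c N q : R).

Lemma powR_lower_bound (c N q p : R) (k : nat) : 0 < c -> 0 <= q -> 0 < p ->
  c * q `^ (k%:R / p) <= N -> c `^ p * q ^+ k <= N `^ p.
Proof.
move=> c0 q0 p0 cN.
have N0 : 0 <= N by apply: le_trans cN; rewrite mulr_ge0 ?powR_ge0 // ltW.
have := ge0_ler_powR (ltW p0) _ _ cN; rewrite !nnegrE mulr_ge0 ?powR_ge0 ?(ltW c0) //.
move=> /(_ isT N0); rewrite powRM ?powR_ge0 ?(ltW c0) // -powRrM.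
by rewrite divfK ?gt_eqF // powR_mulrn.
Qed.

Lemma dist_exponent_le (d : nat) s alpha beta :
  alpha <= beta -> dist_exponent d s alpha -> dist_exponent d s beta.
Proof.
move=> ab H C c C0 c0; have [c' c'0 Hc'] := H C c C0 c0; exists c' => //.
move=> F chi E oF ch1 ch2 sE cE; apply: (Hc' F chi E) => //.
apply: le_trans cE; rewrite ler_wpM2l ?(ltW c0) // ler_powR //.
by rewrite ler1n; apply/card_gt0P; exists 0.
Qed.

Lemma le_card_of_energy (q N D T B k : R) : 0 < N -> 0 <= D -> 0 <= k ->
    N ^+ 3 <= D * T -> q * T <= N ^+ 3 + B -> B <= k * N ^+ 3 ->
  0 <= q -> (1 + k)^-1 * q <= D.
Proof.
move=> N0 D0 k0 h1 h2 h3 q0; rewrite mulrC ler_pdivrMr ?ltr_wpDr //.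
have N3 : 0 < N ^+ 3 by rewrite exprn_gt0.
rewrite -(ler_pM2r N3); apply: le_trans (ler_wpM2l q0 h1) _.
rewrite mulrCA -mulrA ler_wpM2l //; apply: le_trans h2 _.
by rewrite mulrDl mul1r lerD2l.
Qed.

(** A crude root extraction: if x > 1, then x is at most its own power. *)
Lemma le_of_expn_le (x k : R) (n : nat) :
  0 <= x -> 0 <= k -> x ^+ n.+1 <= k -> x <= 1 + k.
Proof.
move=> x0 k0 xk; case: (leP x 1) => [x1|/ltW x1]; first by rewrite ler_wpDr.
by apply: le_trans (le_trans xk _); rewrite ?lerDr // ler_eXnr.
Qed.

Lemma card_gt0_of_le (F : finNzRingType) (V : finType) (E : {set V}) c alpha :
  0 < c -> c * #|F|%:R `^ alpha <= #|E|%:R -> (0 < #|E|)%N.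
Proof.
move=> c0 cE; rewrite -(ltr0n R); apply: lt_le_trans cE.
by rewrite mulr_gt0 // powR_gt0 // ltr0n; apply/card_gt0P; exists 0.
Qed.

Lemma ler_div_of_mul (v x y : R) : 0 < v -> 0 < y -> v * x <= y -> x / y <= v^-1.
Proof. by move=> v0 y0 h; rewrite ler_pdivrMr // ler_pdivlMl. Qed.

Lemma dist_exponent_quartic (d : nat) s :
  0 < s -> dist_exponent d.+1 s (d.+1%:R / (4%:R * s)).
Proof.
move=> s0 C c C0 c0; set v := c `^ (4%:R * s).
have v0 : 0 < v by rewrite powR_gt0.
(* The 2 comes from the sphere bound; the bracket bounds q^d L / N^4, as the size of E gives v q^d
   <= N^(4s) in dimension d. *)
set K := 2%:R * (1 + C ^+ 4 / v).
have K0 : 0 < K by rewrite mulr_gt0 ?ltr_wpDr ?divr_ge0 ?exprn_ge0 // ltW.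
exists K^-1 => [|F chi E oF chE chi1 sE cE]; first by rewrite invr_gt0.
have E0 := card_gt0_of_le c0 cE.
have Z := salem_energy_le chE chi1 E0 (ltW C0) sE.
have W := powR_lower_bound c0 (ler0n _ _) (mulr_gt0 (ltr0Sn _ 3) s0) cE.
have := quartic_energy_bound E; rewrite -(ler_nat R) [X in X <= _]natrM natrX.
rewrite [X in _ <= X]natrM natrM.
move: Z W; set q := #|F|%:R; set N := #|E|%:R; set D := #|dist_set E|%:R.
set Z := (_ * _)%:R; set w := N `^ _; rewrite -/v => ZN vw qN.
have N0 : 0 < N by rewrite ltr0n.
have w0 : 0 < w by rewrite powR_gt0.
have D0 : 0 <= D by rewrite ler0n.
have N4 : 0 < N ^+ 4 by rewrite exprn_gt0.
rewrite mulrC ler_pdivrMr // -(ler_pM2r N4); apply: le_trans qN _.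
rewrite -mulrA ler_wpM2l // /K -mulrA ler_wpM2l //; apply: le_trans ZN _.
rewrite mulrDl mul1r lerD2l.
rewrite (_ : _ / w = C ^+ 4 * (q ^+ d.+1 / w) * N ^+ 4); last by field; rewrite gt_eqF.
rewrite ler_wpM2r ?(ltW N4) // ler_wpM2l ?exprn_ge0 ?(ltW C0) //.
exact: ler_div_of_mul.
Qed.

Lemma dist_exponent_pinned2 (d : nat) s : 0 < s ->
    2%:R <= (d%:R + 2%:R) / (4%:R * s + 1) :> R ->
  dist_exponent d s ((d%:R + 2%:R) / (4%:R * s + 1)).
Proof.
move=> s0 e2 C c C0 c0; set v := c `^ (4%:R * s + 1).
have v0 : 0 < v by rewrite powR_gt0.
(* With B = q T - N^3, (B / N^3)^2 <= q^2 / N + C^4 q^(d+2) / N^(4s+1). The first term is at most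
   1/c because the exponent is at least 2, the second at most C^4 / v. Hence B <= (1 + K) N^3. *)
set K := c^-1 + C ^+ 4 / v.
have K0 : 0 <= K by rewrite addr_ge0 ?divr_ge0 ?invr_ge0 ?exprn_ge0 // ltW.
exists (1 + (1 + K))^-1 => [|F chi E oF [chi0 chiD] chi1 sE cE].
  by rewrite invr_gt0 ltr_wpDr // addr_ge0.
have E0 := card_gt0_of_le c0 cE.
have Z := salem_energy_le (conj chi0 chiD) chi1 E0 (ltW C0) sE.
have B := pinned_energy_excess2 chi0 chiD chi1 oF E.
have BT : ((#|F| * pinned_energy E)%:R <=
  #|E|%:R ^+ 3 + (#|F| * pinned_energy E - #|E| ^ 3)%:R :> R).
  by rewrite -natrX -natrD ler_nat -leq_subLR.
have ND := cube_le_pinned_energy E.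
have q1 : 1 <= #|F|%:R :> R by rewrite ler1n; apply/card_gt0P; exists 0.
have c2 : c * #|F|%:R ^+ 2 <= #|E|%:R.
  apply: le_trans cE; rewrite ler_wpM2l ?(ltW c0) //.
  by rewrite -powR_mulrn ?ler0n // ler_powR.
have p0 : 0 < 4%:R * s + 1 by rewrite ltr_wpDl // mulr_ge0 ?ltW.
have W : v * #|F|%:R ^+ (d + 2) <= #|E|%:R `^ (4%:R * s) * #|E|%:R.
  rewrite -[X in _ <= _ * X](powRr1 (ler0n _ _)) -powRD; last first.
    by apply/implyP => _; rewrite pnatr_eq0 -lt0n.
  by apply: powR_lower_bound => //; rewrite ?ler0n // natrD.
move: B ND BT Z c2 W; rewrite -(ler_nat R) natrX natrM natrX natrM.
rewrite -(ler_nat R) natrX (natrM _ #|dist_set E|) (natrM _ #|F| (pinned_energy E)).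
move: q1; set q := #|F|%:R; set N := #|E|%:R; set D := #|dist_set E|%:R.
set Z := (_ * _)%:R; set w := N `^ _; set B := (_ - _)%:R; set T := (pinned_energy E)%:R.
move=> q1 B2 ND BT ZN cq vw.
have N0 : 0 < N by rewrite ltr0n.
have q0 : 0 < q by apply: lt_le_trans q1.
have w0 : 0 < w by rewrite powR_gt0.
have B0 : 0 <= B by rewrite ler0n.
apply: (le_card_of_energy N0 _ _ ND BT _ (ltW q0)) => //.
  exact: addr_ge0 ler01 K0.
have N3 : 0 < N ^+ 3 by rewrite exprn_gt0.
rewrite -ler_pdivrMr //; apply: (@le_of_expn_le _ _ 1); rewrite ?divr_ge0 ?(ltW N3) //.
rewrite expr_div_n ler_pdivrMr ?exprn_gt0 //; apply: le_trans B2 _.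
apply: (@le_trans _ _ (q ^+ 2 * (N * (N ^+ 4 + C ^+ 4 * q ^+ d * N ^+ 4 / w)))).
  by rewrite ler_wpM2l ?exprn_ge0 ?(ltW q0) // ler_wpM2l ?(ltW N0).
have -> : q ^+ 2 * (N * (N ^+ 4 + C ^+ 4 * q ^+ d * N ^+ 4 / w)) =
    (q ^+ 2 / N + C ^+ 4 * (q ^+ (d + 2) / (w * N))) * N ^+ 3 ^+ 2.
  by rewrite exprD; field; rewrite !gt_eqF.
rewrite ler_wpM2r ?exprn_ge0 ?(ltW N0) // lerD //; first exact: ler_div_of_mul.
by rewrite ler_wpM2l ?exprn_ge0 ?(ltW C0) // ler_div_of_mul // mulr_gt0.
Qed.

Lemma dist_exponent_pinned4 (d : nat) s : 0 < s -> (4 <= d)%N ->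
  dist_exponent d s ((d%:R + 4%:R) / (8%:R * s)).
Proof.
move=> s0 d4 C c C0 c0; set v := c `^ (8%:R * s).
have v0 : 0 < v by rewrite powR_gt0.
(* Here (B / N^3)^4 <= 2 (q^(4-d) + C^8 q^(d+4) / N^(8s)), and d >= 4 makes the first power at most
   1. *)
set K := 2%:R * (1 + C ^+ 8 / v).
have K0 : 0 <= K by rewrite mulr_ge0 ?addr_ge0 ?divr_ge0 ?exprn_ge0 // ltW.
exists (1 + (1 + K))^-1 => [|F chi E oF [chi0 chiD] chi1 sE cE].
  by rewrite invr_gt0 ltr_wpDr // addr_ge0.
have E0 := card_gt0_of_le c0 cE.
have Z := salem_energy_le (conj chi0 chiD) chi1 E0 (ltW C0) sE.
have B := pinned_energy_excess4 chi0 chiD chi1 oF E.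
have BT : ((#|F| * pinned_energy E)%:R <=
  #|E|%:R ^+ 3 + (#|F| * pinned_energy E - #|E| ^ 3)%:R :> R).
  by rewrite -natrX -natrD ler_nat -leq_subLR.
have ND := cube_le_pinned_energy E.
have q1 : 1 <= #|F|%:R :> R by rewrite ler1n; apply/card_gt0P; exists 0.
have W : v * #|F|%:R ^+ (d + 4) <= (#|E|%:R `^ (4%:R * s)) ^+ 2.
  rewrite -[X in _ <= X]powR_mulrn ?powR_ge0 // -powRrM.
  rewrite (_ : 4%:R * s * 2%:R = 8%:R * s); last by ring.
  by apply: powR_lower_bound; rewrite ?ler0n ?mulr_gt0 // natrD.
move: B ND BT Z W; rewrite -(ler_nat R) natrX natrM natrX natrM natrX natrM natrX natrX.
rewrite -(ler_nat R) natrX (natrM _ #|dist_set E|) (natrM _ #|F| (pinned_energy E)).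
rewrite (natrM _ _ (energy E)) natrX.
move: q1; set q := #|F|%:R; set N := #|E|%:R; set D := #|dist_set E|%:R.
set L := (energy E)%:R; set w := N `^ _; set B := (_ - _)%:R.
set T := (pinned_energy E)%:R.
move=> q1 B4 ND BT LN vw.
have N0 : 0 < N by rewrite ltr0n.
have q0 : 0 < q by apply: lt_le_trans q1.
have w0 : 0 < w by rewrite powR_gt0.
have B0 : 0 <= B by rewrite ler0n.
apply: (le_card_of_energy N0 _ _ ND BT _ (ltW q0)) => //.
  exact: addr_ge0 ler01 K0.
have N3 : 0 < N ^+ 3 by rewrite exprn_gt0.
rewrite -ler_pdivrMr //; apply: (@le_of_expn_le _ _ 3); rewrite ?divr_ge0 ?(ltW N3) //.
rewrite expr_div_n ler_pdivrMr ?exprn_gt0 //; apply: le_trans B4 _.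
have qd0 : 0 < q ^+ d by rewrite exprn_gt0.
have LN2 : (q ^+ d * L) ^+ 2 <=
    2%:R * N ^+ 8 * (1 + (C ^+ 4 * q ^+ d / w) ^+ 2).
  apply: (@le_trans _ _ ((N ^+ 4 + C ^+ 4 * q ^+ d * N ^+ 4 / w) ^+ 2)).
    by rewrite lerXn2r // nnegrE ?(le_trans _ LN) // mulr_ge0 ?ler0n ?(ltW qd0).
  (* This is (1 + t)^2 <= 2 (1 + t^2), the difference being (1 - t)^2. *)
  rewrite -subr_ge0 (_ : _ - _ = (N ^+ 4 * (1 - C ^+ 4 * q ^+ d / w)) ^+ 2).
    exact: sqr_ge0.
  by field; rewrite gt_eqF.
have -> : q ^+ 4 * (N ^+ 4 * (q ^+ d * L ^+ 2)) =
    q ^+ 4 * N ^+ 4 / q ^+ d * (q ^+ d * L) ^+ 2 by field; rewrite gt_eqF.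
apply: le_trans (ler_wpM2l _ LN2) _.
  by rewrite divr_ge0 ?mulr_ge0 ?exprn_ge0 ?ltW.
have -> : q ^+ 4 * N ^+ 4 / q ^+ d *
      (2%:R * N ^+ 8 * (1 + (C ^+ 4 * q ^+ d / w) ^+ 2)) =
    2%:R * (q ^+ 4 / q ^+ d + C ^+ 8 * (q ^+ (d + 4) / w ^+ 2)) * N ^+ 3 ^+ 4.
  by rewrite exprD; field; rewrite !gt_eqF.
rewrite ler_wpM2r ?exprn_ge0 ?(ltW N0) // ler_wpM2l // lerD //.
  by rewrite ler_pdivrMr // mul1r ler_weXn2l.
by rewrite ler_wpM2l ?exprn_ge0 ?(ltW C0) // ler_div_of_mul // exprn_gt0.
Qed.
End Exponents.

(* alpha(d,4,s) is the smallest exponent, so that a bound on it also says that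
   the bound is itself an exponent; as the infimum defining alpha4 need not be
   attained a priori, this is stated as the first conjunct. *)
Theorem theorem6 (R : realType) (d : nat) (s : R)
    (hd : (2 <= d)%N) (hs : 4%:R^-1 <= s <= 2%:R^-1) :
  let e1 : R := (d%:R + 2) / (4 * s + 1) in
  let e2 : R := (d%:R + 4) / (8 * s) in
  [/\ dist_exponent d s (Num.min e1 e2),
      (alpha4 d s <= (Num.min e1 e2)%:E)%E,
      s <= 4%:R^-1 + d%:R^-1 -> (alpha4 d s <= e1%:E)%E
    & 4%:R^-1 + d%:R^-1 <= s -> (alpha4 d s <= e2%:E)%E].
Proof.
move=> e1 e2; have /andP[s4 s2] := hs.
have s0 : 0 < s by lra.
have d0 : 0 < d%:R :> R by rewrite ltr0n; case: (d) hd.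
have H1 : dist_exponent d s e1.
  have [le2|lt2] := leP 2%:R e1; first exact: dist_exponent_pinned2.
  apply: dist_exponent_le (_ : d%:R / (4%:R * s) <= e1) _; last first.
    by case: (d) hd => // d' _; apply: dist_exponent_quartic.
  (* Both e1 < 2 and d/(4s) < e1 amount to d < 8s. *)
  move: lt2; rewrite /e1 ltr_pdivrMr ?ler_pdivrMr; [|lra..].
  by rewrite mulrAC ler_pdivlMr; lra.
have H : dist_exponent d s (Num.min e1 e2).
  have [//|lt21] := leP e1 e2.
  (* The inequality e2 < e1 amounts to d + 4 < 4sd, and 4sd <= 2d as s <= 1/2; so d > 4. *)
  apply: dist_exponent_pinned4 => //; rewrite leqNgt; apply/negP => d4.
  have d3 : d%:R <= 3%:R :> R by rewrite ler_nat -ltnS.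
  have ds : d%:R * s <= d%:R * 2%:R^-1 by rewrite ler_wpM2l.
  move: lt21; rewrite /e1 /e2 ltr_pdivrMr; last by lra.
  by rewrite mulrAC ltr_pdivlMr; lra.
have A e : Num.min e1 e2 <= e -> (alpha4 d s <= e%:E)%E.
  move=> le; apply: ereal_inf_lbound; exists e => //.
  exact: dist_exponent_le H.
by split=> // [|_|_]; apply: A; rewrite // ge_min lexx ?orbT.
Qed.
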